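(* Let $n\ge 1$ be an integer and let $G$ be a simple graph. Then $G$ is isomorphic to the complete graph $K_n$ if and only if $$da(G;x,y) = \frac{(1+xy^{2})^{n}-1}{y}\qquad (y\ne 0).$$
   Context: All graphs are finite, simple and have at least one vertex. For a graph $G$, $S\subseteq V(G)$ and $u\in V(G)$, let $\bar S=V(G)\setminus S$, let $\delta_S(u)=|\{v\in S:\{u,v\}\in E(G)\}|$, and let $G[S]$ be the subgraph induced by $S$. The defensive alliance polynomial of $G$ is $$da(G;x,y)=\sum_{S} x^{|S|}\,y^{f_y(S)},\qquad f_y(S)=\min_{u\in S}\bigl(\delta_S(u)-\delta_{\bar S}(u)+|V(G)|\bigr),$$ where the sum runs over all non-empty $S\subseteq V(G)$ such that $G[S]$ is connected (single-vertex graphs are connected). The equality is an identity of functions of $x,y$ (equivalently, of rational functions in $x,y$). *)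

(* Defs.v *)
From mathcomp Require Import all_boot all_order all_algebra.

Set Implicit Arguments.
Unset Strict Implicit.
Unset Printing Implicit Defensive.

Import Order.TTheory GRing.Theory Num.Theory.
Local Open Scope ring_scope.

(* Nonemptiness of the vertex set is not part of the structure; it is a
   separate hypothesis (0 < #|G|) wherever it is wanted. *)
Record sgraph := SGraph {
  vertex :> finType;
  edge : rel vertex;
  edge_sym : symmetric edge;
  edge_irr : irreflexive edge }.

Definition graph_iso (G H : sgraph) : Prop :=
  exists2 f : G -> H, bijective f & {mono f : u v / edge u v}.

Section Complete.
Variable n : nat.

Definition complete_rel : rel 'I_n := [rel i j | i != j].

Lemma complete_sym : symmetric complete_rel.
Proof. by move=> i j; rewrite /complete_rel /= eq_sym. Qed.

Lemma complete_irr : irreflexive complete_rel.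
Proof. by move=> i; rewrite /complete_rel /= eqxx. Qed.

Definition complete_graph : sgraph := SGraph complete_sym complete_irr.
End Complete.

Section Induced.
Variables (G : sgraph) (S : {set G}).

Definition induced_rel : rel {u : G | u \in S} :=
  [rel u v | edge (val u) (val v)].

Lemma induced_sym : symmetric induced_rel.
Proof. by move=> u v; rewrite /induced_rel /= edge_sym. Qed.

Lemma induced_irr : irreflexive induced_rel.
Proof. by move=> u; rewrite /induced_rel /= edge_irr. Qed.

Definition induced_graph : sgraph := SGraph induced_sym induced_irr.
End Induced.

(* The graph without vertices satisfies this predicate; only nonempty graphs
   are tested for connectedness below. *)
Definition connected_graph (G : sgraph) : bool :=
  [forall u : G, forall v : G, connect (@edge G) u v].

Section DefensiveAlliance.
Variable G : sgraph.

Definition deg_in (S : {set G}) (u : G) : nat := #|[set v in S | edge u v]|.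

Definition alliance_index (S : {set G}) (u : G) : int :=
  (deg_in S u)%:Z - (deg_in (~: S) u)%:Z + #|G|%:Z.

(* The neutral value of the iterated minimum is the index of some vertex of S,
   so this is the true minimum over S; the value 0 at S = set0 is junk. *)
Definition min_alliance_index (S : {set G}) : int :=
  if [pick u in S] is Some u0 then
    \big[Order.min/alliance_index S u0]_(u in S) alliance_index S u
  else 0.

(* The exponent of y is an integer, hence the use of the int power _ ^ _. *)
Definition da (R : numFieldType) (x y : R) : R :=
  \sum_(S : {set G} | (S != set0) && connected_graph (induced_graph S))
     x ^+ #|S| * y ^ min_alliance_index S.
End DefensiveAlliance.

(* Main.v *)
Require Import Defs.
From mathcomp Require Import all_boot all_order all_algebra zify.

Import Order.TTheory GRing.Theory Num.Theory.
Local Open Scope ring_scope.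

(** For the complete graph every non-empty [S] is connected and [f_y(S)] is
    [2|S| - 1], so the formula is the binomial theorem. Conversely, setting
    [y = 1] leaves the generating polynomial of the connected vertex sets
    counted by size. Its linear coefficient gives [|V(G)| = n], and its value
    at [x = 1] then says that all [2^n - 1] non-empty sets are connected, in
    particular all pairs of distinct vertices. *)

(** When the product of [z + 1] over [T] is expanded, [S] records the factors from which [z] is
    taken. *)
Lemma sum_expr_card (R : comNzRingType) (T : finType) (z : R) :
  \sum_(S : {set T}) z ^+ #|S| = (1 + z) ^+ #|T|.
Proof.
rewrite -[in RHS]cardsT -prodr_const.
under [RHS]eq_bigl do rewrite inE.
rewrite addrC bigA_distr /=; apply: eq_bigr => S _.
by rewrite -big_mkcond prodr_const.
Qed.

Lemma sum_expr_card_neq0 (R : comNzRingType) (T : finType) (z : R) :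
  \sum_(S : {set T} | S != set0) z ^+ #|S| = (1 + z) ^+ #|T| - 1.
Proof.
rewrite -sum_expr_card [in RHS](bigD1 set0) //=.
by rewrite cards0 expr0 [RHS]addrC addKr.
Qed.

(** A nonzero [p - q] would have the roots 0, 1, ..., [size (p - q)] - 1, distinct in characteristic
    zero and one more than its degree. *)
Lemma poly_eq_horner (R : numDomainType) (p q : {poly R}) :
  (forall x, p.[x] = q.[x]) -> p = q.
Proof.
move=> pq; apply/eqP; rewrite -subr_eq0; apply/negPn/negP => nz.
pose rs := [seq i%:R : R | i <- iota 0 (size (p - q))].
have: (size rs < size (p - q)%R)%N.
  apply: max_poly_roots => //.
    by apply/allP => x _; rewrite rootE !hornerE pq subrr.
  by rewrite map_inj_uniq ?iota_uniq //; apply: mulrIn; rewrite oner_eq0.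
by rewrite size_map size_iota ltnn.
Qed.

Lemma min_alliance_index_const (G : sgraph) (S : {set G}) (c : int) :
  S != set0 -> {in S, forall u, alliance_index S u = c} ->
  min_alliance_index S = c.
Proof.
move=> /set0Pn[v vS] indc; rewrite /min_alliance_index.
case: pickP => [u uS | /(_ v)]; last by rewrite vS.
(* The neutral value of the minimum is the index of [u] in [S], hence also [c]. *)
rewrite indc // (eq_bigr (fun=> c)) //.
by elim/big_ind: _ => // a b -> ->; rewrite minxx.
Qed.

Lemma connected_set1 (G : sgraph) (u : G) :
  connected_graph (induced_graph [set u]).
Proof.
apply/forallP => a; apply/forallP => b.
suff -> : a = b by exact: connect0.
apply: val_inj; have /set1P-> := valP a; by have /set1P-> := valP b.
Qed.

(** The first step of a path from [u] to [v] within the pair cannot stay at [u], so it is the edge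
    to [v]. *)
Lemma edge_of_connected_pair (G : sgraph) (u v : G) :
  u != v -> connected_graph (induced_graph [set u; v]) -> edge u v.
Proof.
move=> uv /forallP/(_ (Sub u (set21 u v)))/forallP/(_ (Sub v (set22 u v))).
case/connectP => [[|w p]] /= => [_ /(congr1 val)/= vu|].
  by rewrite vu eqxx in uv.
case/andP; rewrite /induced_rel /= => uw _ _.
have /set2P[wu|<- //] := valP w.
by rewrite wu edge_irr in uw.
Qed.

Section CompleteAdjacency.
Variables (G : sgraph) (edgeE : forall u v : G, edge u v = (u != v)).

Lemma connected_complete (S : {set G}) : connected_graph (induced_graph S).
Proof.
apply/forallP => a; apply/forallP => b.
have [-> | ab] := eqVneq a b; first exact: connect0.
by apply: connect1; rewrite /= /induced_rel /= edgeE (inj_eq val_inj).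
Qed.

(** All other members of [S] and all outside vertices are neighbours of [u]: (|S| - 1) - (|G| - |S|)
    + |G| = 2|S| - 1. *)
Lemma alliance_index_complete (S : {set G}) (u : G) :
  u \in S -> alliance_index S u = (#|S|.*2)%:Z - 1.
Proof.
move=> uS; have cS : #|S| = (deg_in S u).+1.
  rewrite (cardsD1 u S) uS; congr _.+1; apply: eq_card => v.
  by rewrite !inE edgeE eq_sym andbC.
have dC : deg_in (~: S) u = #|~: S|.
  apply: eq_card => v; rewrite !inE edgeE.
  by case: (eqVneq u v) => [<-|_]; rewrite ?uS ?andbT.
by rewrite /alliance_index dC -(cardsC S) cS; lia.
Qed.

Lemma da_complete (R : numFieldType) (x y : R) :
  y != 0 -> da G x y = ((1 + x * y ^+ 2) ^+ #|G| - 1) / y.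
Proof.
move=> y0; rewrite -sum_expr_card_neq0 mulr_suml /da.
apply: eq_big => [S | S /andP[S0 _]].
  by rewrite connected_complete andbT.
rewrite (min_alliance_index_const _ _ _ S0 (@alliance_index_complete S)).
(* With k = |S|, x^k y^(2k-1) = (x y^2)^k / y; splitting the exponent uses [y != 0]. *)
by rewrite expfzDr // -exprnP exprN1 -mul2n exprM mulrA -exprMn.
Qed.

End CompleteAdjacency.

Lemma graph_iso_completeP (G : sgraph) (n : nat) :
  graph_iso G (complete_graph n) <->
  #|G| = n /\ (forall u v : G, edge u v = (u != v)).
Proof.
split=> [[f bij_f mono_f] | [<- edgeE]].
  split; first by rewrite (bij_eq_card bij_f) card_ord.
  by move=> u v; rewrite -mono_f /= /complete_rel /= (bij_eq bij_f).
exists (@enum_rank G); first exact: enum_rank_bij.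
by move=> u v; rewrite edgeE /= /complete_rel /= (inj_eq enum_rank_inj).
Qed.

Section FromPolynomial.
Variables (R : numFieldType) (n : nat) (G : sgraph).
Hypothesis da1 : forall x : R, da G x 1 = (1 + x) ^+ n - 1.

Let alliances : pred {set G} :=
  fun S => (S != set0) && connected_graph (induced_graph S).

Lemma da_y1 (x : R) : da G x 1 = \sum_(S | alliances S) x ^+ #|S|.
Proof. by apply: eq_bigr => S _; rewrite exp1rz mulr1. Qed.

Lemma card_of_da : #|G| = n.
Proof.
(* The derivative at 0 reads off the linear coefficient. *)
have /poly_eq_horner/(congr1 (fun p : {poly R} => p^`().[0])) : forall x : R,
    (\sum_(S | alliances S) 'X^#|S|).[x] = ((1 + 'X) ^+ n - 1).[x].
  move=> x; rewrite !hornerE -da1 da_y1 horner_sum.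
  by apply: eq_bigr => S _; rewrite hornerXn.
rewrite derivB derivC subr0 deriv_exp derivD derivX derivC add0r mul1r.
rewrite hornerMn !hornerE expr1n raddf_sum horner_sum /=.
(* Only sets of size 1 contribute; they are the singletons, all connected, one per vertex. *)
rewrite (bigID (fun S : {set G} => #|S| == 1%N)) /= [X in _ + X]big1 ?addr0.
  move=> E; apply/eqP; rewrite -(eqr_nat R) -E; apply/eqP.
  rewrite (eq_bigr (fun=> 1)) => [|S /andP[_ /eqP->]]; last first.
    by rewrite derivXn expr0 hornerC.
  rewrite sumr_const; congr _%:R.
  rewrite -(card_imset predT (@set1_inj G)); apply: eq_card => S.
  apply/imsetP/andP => [[u _ ->] | [_ /cards1P[u ->]]]; last by exists u.
  rewrite cards1; split=> //; apply/andP; split; last exact: connected_set1.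
  by apply/set0Pn; exists u; rewrite set11.
move=> S /andP[/andP[S0 _]]; rewrite -card_gt0 in S0.
by case: #|S| S0 => [|[|k]] // _ _; rewrite derivXn hornerMn hornerXn expr0n mul0rn.
Qed.

Lemma connected_of_da (S : {set G}) :
  S != set0 -> connected_graph (induced_graph S).
Proof.
move=> S0; apply/negPn/negP => ncS.
have := sum_expr_card_neq0 R G 1; rewrite card_of_da -da1 da_y1.
rewrite (bigID (fun S => connected_graph (induced_graph S))) /=.
(* Cancelling the connected sets leaves the number of disconnected non-empty sets, which is 0 in [R]
   and so 0 as a natural number. *)
rewrite -[RHS]addr0 => /addrI.
under eq_bigr do rewrite expr1n.
rewrite sumr_const => /eqP; rewrite pnatr_eq0 => /eqP/card0_eq/(_ S).
by rewrite unfold_in /= S0 ncS.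
Qed.

End FromPolynomial.

Theorem proposition20 (R : numFieldType) (n : nat) (hn : (1 <= n)%N)
    (G : sgraph) (hG : (0 < #|G|)%N) :
  graph_iso G (complete_graph n) <->
  (forall x y : R, y != 0 -> da G x y = ((1 + x * y ^+ 2) ^+ n - 1) / y).
Proof.
rewrite graph_iso_completeP; split=> [[<- edgeE] x y | daE].
  exact: da_complete.
have da1 (x : R) : da G x 1 = (1 + x) ^+ n - 1.
  by rewrite daE ?oner_eq0 // expr1n mulr1 divr1.
split=> [|u v]; first exact: (card_of_da _ _ _ da1).
have [<-|uv] := eqVneq u v; first exact: edge_irr.
apply: edge_of_connected_pair => //; apply: (connected_of_da _ _ _ da1).
by apply/set0Pn; exists u; rewrite set21.
Qed.
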